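(* Let $\varepsilon>0$ be the lattice distance, let $\ell\in\mathbb{Z}^3$ and let $\eta=(\eta_1,\eta_2,\eta_3)\in\mathbb{Z}^3$ with $\eta_1\eta_2\eta_3\neq 0$. Let $v$ be a continuous function on $\overline{B_{\ell,\eta}}$, with values in $\mathbb{R}^3$, which is piecewise linear (i.e. affine on each tetrahedron) on a type A decomposition of the bond volume $B_{\ell,\eta}$ into tetrahedra. Then $$\varepsilon^3\,\overline D_\eta v_\ell=\frac{1}{|\eta_1\,\eta_2\,\eta_3|}\int_{B_{\ell,\eta}}\nabla v(x)\,\eta\,dx .$$
   Context: For $\ell\in\mathbb{Z}^3$ write $x_\ell=\varepsilon\ell\in\varepsilon\mathbb{Z}^3$, and $v_\ell=v(x_\ell)$. The difference quotient in direction $\eta$ is $\overline D_\eta v_\ell=\dfrac{v_{\ell+\eta}-v_\ell}{\varepsilon}$. $\nabla v=\{\partial v^i/\partial x_\alpha\}_{i\alpha}$, and $\nabla v\,\eta$ is the matrix-vector product (defined a.e.). Let $e_1,e_2,e_3$ be the standard basis of $\mathbb{R}^3$. Bond volume: for $\eta_1\eta_2\eta_3\ne0$, $B_{\ell,\eta}$ is the interior of the rectangular parallelepiped with edges parallel to the $e_i$ and with main diagonal the segment from $x_\ell$ to $x_{\ell+\eta}$; its vertices are $x_{\ell+\sum_{i\in I}\eta_i e_i}$, $I\subset\{1,2,3\}$. Type A decomposition of $B_{\ell,\eta}$: the decomposition of $B_{\ell,\eta}$ into six tetrahedra whose edges are the edges of $B_{\ell,\eta}$, the main diagonal from $x_\ell$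 to $x_{\ell+\eta}$, the three face diagonals starting at $x_\ell$, and the three face diagonals starting at $x_{\ell+\eta}$. *)

(* Defs.v *)
From mathcomp Require Import all_boot all_order all_algebra.
From mathcomp Require Import all_classical all_reals all_analysis.
Set Implicit Arguments.
Unset Strict Implicit.
Unset Printing Implicit Defensive.
Import Order.TTheory GRing.Theory Num.Theory.
Import numFieldNormedType.Exports.
Local Open Scope classical_set_scope.
Local Open Scope ring_scope.

(* Points of R^3 are column vectors 'cV[R]_3, so that the gradient acts on them
   by left multiplication; lattice indices are integer column vectors. *)

Definition intvec (R : realType) (k : 'cV[int]_3) : 'cV[R]_3 :=
  map_mx intr k.

Definition lattice_pt (R : realType) (eps : R) (l : 'cV[int]_3) : 'cV[R]_3 :=
  eps *: intvec R l.

Definition diff_quot (R : realType) (eps : R) (eta : 'cV[int]_3)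
    (v : 'cV[R]_3 -> 'cV[R]_3) (l : 'cV[int]_3) : 'cV[R]_3 :=
  eps^-1 *: (v (lattice_pt eps (l + eta)) - v (lattice_pt eps l)).

Definition parallelepiped (R : realType) (p q : 'cV[R]_3) : set 'cV[R]_3 :=
  [set x | forall i : 'I_3,
     Num.min (p i 0) (q i 0) <= x i 0 <= Num.max (p i 0) (q i 0)].

Definition bond_volume (R : realType) (eps : R) (l eta : 'cV[int]_3) :
    set 'cV[R]_3 :=
  interior (parallelepiped (lattice_pt eps l) (lattice_pt eps (l + eta))).

Definition bond_vertex (R : realType) (eps : R) (l eta : 'cV[int]_3)
    (I : {set 'I_3}) : 'cV[R]_3 :=
  lattice_pt eps (l + \sum_(i in I) eta i 0 *: delta_mx i 0).

(* Each segment is listed with one orientation only. The diagonal of a face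
   starting at x_l ends at the vertex with #|I| = 2, and the one starting at
   x_(l + eta) ends at the vertex with #|I| = 1. *)
Inductive typeA_segment (R : realType) (eps : R) (l eta : 'cV[int]_3) :
    'cV[R]_3 -> 'cV[R]_3 -> Prop :=
| typeA_box_edge (I : {set 'I_3}) (i : 'I_3) of i \notin I :
    typeA_segment eps l eta
      (bond_vertex eps l eta I) (bond_vertex eps l eta (i |: I)%SET)
| typeA_main_diagonal :
    typeA_segment eps l eta (lattice_pt eps l) (lattice_pt eps (l + eta))
| typeA_face_diagonal_start (I : {set 'I_3}) of #|I| = 2%N :
    typeA_segment eps l eta (lattice_pt eps l) (bond_vertex eps l eta I)
| typeA_face_diagonal_end (I : {set 'I_3}) of #|I| = 1%N :
    typeA_segment eps l eta
      (lattice_pt eps (l + eta)) (bond_vertex eps l eta I).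

(* A tetrahedron is given by its four vertices. *)

Definition affinely_independent (R : realType) (p : 'I_4 -> 'cV[R]_3) : Prop :=
  forall c : 'I_4 -> R,
    \sum_k c k = 0 -> \sum_k c k *: p k = 0 -> forall k, c k = 0.

Definition tetrahedron (R : realType) (p : 'I_4 -> 'cV[R]_3) : set 'cV[R]_3 :=
  [set x | exists c : 'I_4 -> R,
     [/\ forall k, 0 <= c k, \sum_k c k = 1 & x = \sum_k c k *: p k]].

Definition tetrahedral_edge (R : realType) (n : nat)
    (T : 'I_n -> 'I_4 -> 'cV[R]_3) (a b : 'cV[R]_3) : Prop :=
  exists (t : 'I_n) (j k : 'I_4), [/\ j != k, a = T t j & b = T t k].

Definition tetrahedral_decomposition (R : realType) (n : nat)
    (B : set 'cV[R]_3) (T : 'I_n -> 'I_4 -> 'cV[R]_3) : Prop :=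
  [/\ forall t, affinely_independent (T t),
      forall s t, s != t ->
        interior (tetrahedron (T s)) `&` interior (tetrahedron (T t)) = set0
    & \bigcup_t tetrahedron (T t) = closure B].

Definition typeA_decomposition (R : realType) (eps : R) (l eta : 'cV[int]_3)
    (T : 'I_6 -> 'I_4 -> 'cV[R]_3) : Prop :=
  tetrahedral_decomposition (bond_volume eps l eta) T /\
  forall a b : 'cV[R]_3, tetrahedral_edge T a b <->
    (typeA_segment eps l eta a b \/ typeA_segment eps l eta b a).

Definition affine_on (R : realType) (D : set 'cV[R]_3)
    (v : 'cV[R]_3 -> 'cV[R]_3) : Prop :=
  exists (A : 'M[R]_3) (b : 'cV[R]_3), forall x, D x -> v x = A *m x + b.

(* At points where a partial derivative does not exist the entry is the
   library's default value of 'D; for piecewise affine v these points form a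
   null set. *)
Definition grad (R : realType) (v : 'cV[R]_3 -> 'cV[R]_3) (x : 'cV[R]_3) :
    'M[R]_3 :=
  \matrix_(i, a) 'D_(delta_mx a 0) (fun y : 'cV[R]_3 => v y i 0) x.

(* Lebesgue measure on R^3 is the product measure on triples; integrals over
   subsets of 'cV[R]_3 are transported along vec3. *)

Definition lebesgue3 (R : realType) :=
  ((@lebesgue_measure R \x @lebesgue_measure R) \x @lebesgue_measure R)%E.

Definition vec3 (R : realType) (p : R * R * R) : 'cV[R]_3 :=
  \col_i nth 0 [:: p.1.1; p.1.2; p.2] i.

Definition integral3 (R : realType) (D : set 'cV[R]_3)
    (F : 'cV[R]_3 -> 'cV[R]_3) : 'cV[R]_3 :=
  \col_i Rintegral (@lebesgue3 R) (@vec3 R @^-1` D) (fun p => F (vec3 p) i 0).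

(* Main.v *)
Require Import Defs.
From mathcomp Require Import all_boot all_order all_algebra.
From mathcomp Require Import all_classical all_reals all_analysis.
From mathcomp Require Import measurable_realfun.
Set Implicit Arguments.
Unset Strict Implicit.
Unset Printing Implicit Defensive.
Import Order.TTheory GRing.Theory Num.Theory.
Import numFieldNormedType.Exports.
Local Open Scope classical_set_scope.
Local Open Scope ring_scope.

(** The main diagonal is an edge of every tetrahedron of a type A
    decomposition. Indeed, the vertices of the parallelepiped are indexed by the
    subsets of {1, 2, 3}, and two distinct vertices are joined by a segment of
    type A exactly when their index sets are comparable for inclusion; the four
    vertices of a tetrahedron, being pairwise joined, therefore form a maximal
    chain, which contains the empty set (the point x_l) and the full set (the
    point x_(l + eta)). This is [typeA_main_diagonal_vertices].

    On a tetrahedron v is affine, v x = A x + b, so that in its interior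
    grad v x * eta = A eta = (v x_(l + eta) - v x_l) / eps: the integrand takes
    one and the same value, the difference quotient, in the interiors of all
    six tetrahedra. The integral is this value times the volume
    eps^3 |eta_1 eta_2 eta_3| of the bond.

    What remains is measure theory. A point of a tetrahedron outside its
    interior has a vanishing barycentric coordinate, hence lies in one of
    finitely many planes ([tetrahedron_negligible_boundary]), and planes are
    null sets ([hyperplane_negligible]). On these planes the integrand is the
    value of limits that need not exist; [integral_ae] shows that, whether or
    not it is measurable there, its integral depends only on its values
    outside a null set. *)

(** * Integrals of functions that agree outside a null set *)

Section integral_ae.
Import HBNNSimple.
Local Open Scope ereal_scope.

(** The integral of a nonnegative function is the supremum of the integrals of
    the simple functions below it. Since a simple function is measurable,
    cutting it off on a null set does not change its integral, and the simple
    function so obtained is below [g]. *)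
Lemma ge0_le_integral_negligible d (X : measurableType d) (R : realType)
    (mu : {measure set X -> \bar R}) (f g : X -> \bar R) :
  (forall x, 0 <= f x) -> (forall x, 0 <= g x) ->
  mu.-negligible [set x | ~ f x <= g x] ->
  \int[mu]_x f x <= \int[mu]_x g x.
Proof.
move=> f0 g0 [N [mN N0 fgN]].
rewrite ge0_integralTE//; apply: ge_ereal_sup => _ /= [h hf <-].
have mNC := measurableC mN.
have -> : sintegral mu h = sintegral mu (proj_nnsfun h mNC).
  rewrite -!integralT_nnsfun; apply: ge0_ae_eq_integral => //.
  - exact: measurableT_comp.
  - exact: measurableT_comp.
  - by move=> x _; rewrite lee_fin.
  - by move=> x _; rewrite lee_fin.
  exists N; split => // x /= /not_implyP[_ hx]; apply: contrapT => xN.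
  by apply: hx; rewrite mindicE mem_set// mulr1.
rewrite ge0_integralTE//; apply: ereal_sup_ubound => /=.
exists (proj_nnsfun h mNC) => // x; rewrite /= mindicE.
have [xN|xN] := boolP (x \in ~` N); last by rewrite mulr0.
rewrite mulr1; apply: le_trans (hf x) _; apply: contrapT => fgx.
by move: xN; rewrite inE => /(_ (fgN _ fgx)).
Qed.

Lemma ge0_integral_ae d (X : measurableType d) (R : realType)
    (mu : {measure set X -> \bar R}) (f g : X -> \bar R) :
  (forall x, 0 <= f x) -> (forall x, 0 <= g x) ->
  mu.-negligible [set x | f x <> g x] ->
  \int[mu]_x f x = \int[mu]_x g x.
Proof.
move=> f0 g0 fg; apply/eqP; rewrite eq_le !ge0_le_integral_negligible//.
- by apply: negligibleS fg => x; apply: contra_not => ->.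
- by apply: negligibleS fg => x; apply: contra_not => ->.
Qed.

Lemma integral_ae d (X : measurableType d) (R : realType)
    (mu : {measure set X -> \bar R}) (f g : X -> \bar R) :
  mu.-negligible [set x | f x <> g x] ->
  \int[mu]_x f x = \int[mu]_x g x.
Proof.
move=> fg; rewrite [LHS]integralE [RHS]integralE.
congr (_ - _); apply: ge0_integral_ae => //.
- by apply: negligibleS fg => x /=; apply: contra_not; rewrite !funeposE => ->.
- by apply: negligibleS fg => x /=; apply: contra_not; rewrite !funenegE => ->.
Qed.

End integral_ae.

(** The domain [D] may differ from [E] on a null set, so that only the
    measurability of [E] is at stake. *)
Lemma Rintegral_ae_cst d (X : measurableType d) (R : realType)
    (mu : {measure set X -> \bar R}) (D E : set X) (f : X -> R) (k : R) :
  measurable E -> mu E \is a fin_num ->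
  mu.-negligible [set x | ~ ((D x <-> E x) /\ (D x -> f x = k))] ->
  Rintegral mu D f = k * fine (mu E).
Proof.
move=> mE muE DE; rewrite /Rintegral integral_mkcond.
rewrite (@integral_ae _ _ _ _ _ (cst k%:E \_ E)); last first.
  apply: negligibleS DE => x /=; apply: contra_not => -[DEx fk].
  rewrite !patchE; have [xE|xE] := boolP (x \in E).
    have Dx : D x by apply/DEx; move: xE; rewrite inE.
    by rewrite mem_set//= fk.
  by rewrite memNset// => /DEx Ex; move: xE; rewrite mem_set.
by rewrite -integral_mkcond integral_cst//= fineM.
Qed.

(** * Planes are null sets *)

Lemma negligible_exists d (X : measurableType d) (R : realType)
    (mu : {measure set X -> \bar R}) (I : finType) (F : I -> set X) :
  (forall i, mu.-negligible (F i)) -> mu.-negligible [set x | exists i, F i x].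
Proof.
move=> F0; pose G n := if unpickle n is Some i then F i else set0.
apply: (@negligibleS _ _ _ _ (\bigcup_n G n)).
  by move=> x /= [i Fix]; exists (pickle i) => //; rewrite /G pickleK.
apply: negligible_bigcup => n; rewrite /G; case: unpickle => //.
exact: negligible_set0.
Qed.

Lemma product_measure_null_sections d1 d2 (X1 : measurableType d1)
    (X2 : measurableType d2) (R : realType)
    (m1 : {measure set X1 -> \bar R}) (m2 : {sigma_finite_measure set X2 -> \bar R})
    (A : set (X1 * X2)) :
  (forall x, m2 (xsection A x) = 0%E) -> (m1 \x m2)%E A = 0%E.
Proof. by move=> A0; rewrite [LHS]integral0_eq// => x _; exact: A0. Qed.

Lemma affine_root_set1 (F : fieldType) (b d : F) : b != 0 ->
  [set y | b * y + d = 0] = [set - d / b].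
Proof.
move=> b0; apply/seteqP; split => y /=.
  by move=> /eqP; rewrite addr_eq0 => /eqP <-; rewrite mulrC mulKf// opprK.
by move=> ->; rewrite mulrC divfK// addNr.
Qed.

Lemma lebesgue_measure2_line (R : realType) (a b d : R) :
    (a != 0) || (b != 0) ->
  (@lebesgue_measure R \x @lebesgue_measure R)%E
    [set p | a * p.1 + b * p.2 + d = 0] = 0%E.
Proof.
have [->|b0] := eqVneq b 0; last first.
  move=> _; apply: product_measure_null_sections => x.
  rewrite -[RHS](lebesgue_measure_set1 (- (a * x + d) / b)) -affine_root_set1//.
  congr (lebesgue_measure _); apply/seteqP.
  by split => y; rewrite /xsection/= inE/= addrCA addrA.
rewrite orbF => a0.
rewrite (_ : [set p | _] = [set - d / a] `*` [set: R]).
  by rewrite product_measure1E// [X in (X * _)%E]lebesgue_measure_set1 mul0e.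
rewrite -affine_root_set1//; apply/seteqP.
by split => -[x y] /=; rewrite mul0r addr0 //; case.
Qed.

(** By Tonelli: a plane that is not parallel to the third axis meets each line
    in that direction in one point, and a plane parallel to it is the product of
    a line of the first two coordinates and the third axis, whose measure is
    0 * oo = 0. *)
Lemma hyperplane_negligible (R : realType) (a : 'rV[R]_3) (d : R) : a != 0 ->
  (@lebesgue3 R).-negligible (@vec3 R @^-1` [set x | (a *m x) 0 0 + d = 0]).
Proof.
move=> a0; set H := _ @^-1` _; rewrite /lebesgue3.
pose i0 : 'I_3 := 0; pose i1 : 'I_3 := 1; pose i2 : 'I_3 := 2.
have aE p : (a *m vec3 p) 0 0 = a 0 i0 * p.1.1 + a 0 i1 * p.1.2 + a 0 i2 * p.2.
  rewrite mxE !big_ord_recr/= big_ord0 add0r !mxE/=.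
  by congr (_ + _ + _); congr (a _ _ * _); apply: val_inj.
pose f (p : measurableTypeR R * measurableTypeR R * measurableTypeR R) : R :=
  a 0 i0 * p.1.1 + a 0 i1 * p.1.2 + a 0 i2 * p.2 + d.
have mf : measurable_fun setT f.
  apply: measurable_funD => //; apply: measurable_funD; last exact: measurable_funM.
  apply: measurable_funD; apply: measurable_funM => //.
    by apply: (measurableT_comp measurable_fst).
  by apply: (measurableT_comp measurable_snd).
exists H; split => //.
  rewrite (_ : H = setT `&` f @^-1` [set 0]); first exact: mf (measurable_set1 0).
  by rewrite setTI; apply/funext => p; congr (_ + d = 0); exact: aE.
have [a2|a2] := eqVneq (a 0 i2) 0; last first.
  apply: product_measure_null_sections => x.
  rewrite -[RHS](lebesgue_measure_set1 (- (a 0 i0 * x.1 + a 0 i1 * x.2 + d) / a 0 i2)).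
  rewrite -affine_root_set1//.
  congr (lebesgue_measure _); apply/seteqP; split => y;
    by rewrite /xsection/= inE /H/= aE/= [_ + (_ + d)]addrCA addrA.
set L := [set p : R * R | a 0 i0 * p.1 + a 0 i1 * p.2 + d = 0].
rewrite (_ : H = L `*` [set: R]).
  rewrite product_measure1E//; last first.
    rewrite -[L]setTI.
    suff mL : measurable_fun setT (fun p : R * R => a 0 i0 * p.1 + a 0 i1 * p.2 + d).
      exact: mL (measurable_set1 0).
    by do ?apply: measurable_funD => //; apply: measurable_funM.
  rewrite [X in (X * _)%E]lebesgue_measure2_line ?mul0e//.
  apply: contraNT a0; rewrite negb_or !negbK => /andP[/eqP a0' /eqP a1].
  apply/eqP/rowP => i; rewrite mxE.
  by case: i => -[|[|[|//]]] i; [rewrite -a0'|rewrite -a1|rewrite -a2];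
    congr (a _ _); apply: val_inj.
apply/seteqP.
by split => -[x y] /=; rewrite /H/= aE/= a2 mul0r addr0 //; case.
Qed.

Lemma coordinate_plane_negligible (R : realType) (i : 'I_3) (r : R) :
  (@lebesgue3 R).-negligible (@vec3 R @^-1` [set x | x i 0 = r]).
Proof.
have : delta_mx 0 i != 0 :> 'rV[R]_3.
  by apply/eqP => /rowP/(_ i)/eqP; rewrite !mxE !eqxx oner_eq0.
move/(hyperplane_negligible (- r)); apply: negligibleS => z /= zi.
by rewrite -rowE mxE zi subrr.
Qed.

(** * Rectangular boxes *)

(** A product of open intervals, hence measurable and of known volume. It agrees
    with the interior of [parallelepiped p q] off the planes that carry the
    faces, which is all that an integral over the interior can see. *)
Definition open_box (R : realType) (p q : 'cV[R]_3) : set 'cV[R]_3 :=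
  [set x | forall i : 'I_3,
     Num.min (p i 0) (q i 0) < x i 0 < Num.max (p i 0) (q i 0)].

Lemma open_box_sub_interior (R : realType) (p q : 'cV[R]_3) :
  open_box p q `<=` interior (parallelepiped p q).
Proof.
move=> x xpq; rewrite /interior/=.
have : \forall y \near x, forall i : 'I_3,
    Num.min (p i 0) (q i 0) < (y : 'cV[R]_3) i 0 < Num.max (p i 0) (q i 0).
  apply: (@filter_forall _ _ (fun i (y : 'cV[R]_3) =>
    Num.min (p i 0) (q i 0) < y i 0 < Num.max (p i 0) (q i 0)) (nbhs x)) => i.
  have /andP[px xq] := xpq i.
  have nearx : \forall z \near x i 0,
      Num.min (p i 0) (q i 0) < z < Num.max (p i 0) (q i 0).
    by near=> z; apply/andP; split; near: z; [exact: lt_nbhsr|exact: lt_nbhsl].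
  exact: (@coord_continuous _ _ _ i 0 x _ nearx).
by apply: filterS => y yb i; have /andP[/ltW-> /ltW->] := yb i.
Unshelve. all: by end_near. Qed.

Lemma parallelepiped_open_boxP (R : realType) (p q x : 'cV[R]_3) :
  (forall i, x i 0 != p i 0 /\ x i 0 != q i 0) ->
  parallelepiped p q x <-> open_box p q x.
Proof.
move=> xpq; split => xP i; have /andP[px xq] := xP i; last by rewrite !ltW.
have [xp xq'] := xpq i; rewrite !lt_neqAle px xq !andbT; apply/andP; split.
  by rewrite eq_sym /Order.min; case: ifP.
by rewrite /Order.max; case: ifP.
Qed.

Lemma lebesgue_measure_min_max (R : realType) (a b : R) :
  lebesgue_measure `]Num.min a b, Num.max a b[%classic = `|b - a|%:E.
Proof.
rewrite lebesgue_measure_itv/= lte_fin.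
have [ab|ba|->] := ltgtP a b; last by rewrite ltxx subrr normr0.
  by rewrite ab gtr0_norm ?subr_gt0.
by rewrite ba ltr0_norm ?subr_lt0// opprB.
Qed.

Lemma preimage_open_box (R : realType) (p q : 'cV[R]_3) :
  let J (i : 'I_3) := `]Num.min (p i 0) (q i 0), Num.max (p i 0) (q i 0)[%classic in
  @vec3 R @^-1` open_box p q = (J 0 `*` J 1) `*` J 2.
Proof.
move=> J; apply/seteqP; split => -[[x y] z] /=.
  move=> xyz; have := (xyz 0, xyz 1, xyz 2); rewrite /J !mxE/=.
  by rewrite !in_itv/= => -[[-> ->] ->].
rewrite /J/= !in_itv/= => -[[x0 y1] z2] i; rewrite mxE/=.
case: i => -[|[|[|//]]] i /=.
- by rewrite (_ : Ordinal i = 0)//; exact: val_inj.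
- by rewrite (_ : Ordinal i = 1)//; exact: val_inj.
- by rewrite (_ : Ordinal i = 2)//; exact: val_inj.
Qed.

Lemma measurable_open_box (R : realType) (p q : 'cV[R]_3) :
  measurable (@vec3 R @^-1` open_box p q).
Proof.
by rewrite preimage_open_box; do 2?apply: measurableX; exact: measurable_itv.
Qed.

Lemma lebesgue3_open_box (R : realType) (p q : 'cV[R]_3) :
  lebesgue3 (@vec3 R @^-1` open_box p q) = (\prod_i `|q i 0 - p i 0|)%:E.
Proof.
rewrite preimage_open_box /lebesgue3.
rewrite product_measure1E//; last by apply: measurableX.
rewrite [X in (X * _)%E]product_measure1E//.
rewrite [X in (X * _ * _)%E]lebesgue_measure_min_max.
rewrite [X in (_ * X * _)%E]lebesgue_measure_min_max.
rewrite [X in (_ * X)%E]lebesgue_measure_min_max.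
rewrite !big_ord_recr/= big_ord0 mul1r -!EFinM.
by congr (_ * _ * _)%:E; congr (`|q _ _ - p _ _|); apply: val_inj.
Qed.

Lemma integral3_ae_const (R : realType) (D : set 'cV[R]_3)
    (F : 'cV[R]_3 -> 'cV[R]_3) (p q k : 'cV[R]_3) :
  (@lebesgue3 R).-negligible (@vec3 R @^-1` [set x |
    ~ ((D x <-> open_box p q x) /\ (D x -> F x = k))]) ->
  integral3 D F = (\prod_i `|q i 0 - p i 0|) *: k.
Proof.
move=> DF; apply/colP => i; rewrite !mxE.
transitivity (k i 0 * fine (lebesgue3 (@vec3 R @^-1` open_box p q))).
  apply: Rintegral_ae_cst; first exact: measurable_open_box.
    by rewrite fin_num_abs [X in `|X|%E]lebesgue3_open_box ltry.
  apply: negligibleS DF => z /=; apply: contra_not => -[DO Fk].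
  by split => // /Fk ->.
by rewrite lebesgue3_open_box mulrC.
Qed.

(** * Tetrahedra *)

Lemma ord4_neqD1 (k : 'I_4) : k != k + 1.
Proof. by case: k => -[|[|[|[|]]]]. Qed.

(** The barycentric coordinates of [x] solve the linear system whose matrix has
    the columns [(p k, 1)] and whose right-hand side is [(x, 1)]; affine
    independence makes this matrix invertible, so they are affine functions of
    [x]. None of them is constant, since it takes the values 0 and 1 at the
    vertices, hence its zero set is a plane. *)
Lemma barycentric_coordinates (R : realType) (p : 'I_4 -> 'cV[R]_3) :
  affinely_independent p ->
  exists (a : 'I_4 -> 'rV[R]_3) (d : 'I_4 -> R),
    let c k x := (a k *m x) 0 0 + d k in
    [/\ forall k, a k != 0,
        forall x, \sum_k c k x = 1 /\ x = \sum_k c k x *: p k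
      & forall e x, \sum_k e k = 1 -> x = \sum_k e k *: p k ->
          forall k, e k = c k x].
Proof.
move=> pI.
pose M : 'M[R]_(3 + 1) :=
  col_mx (\matrix_(i < 3, k < 4) p k i 0) (const_mx 1).
have ME (e : 'cV[R]_(3 + 1)) :
    M *m e = col_mx (\sum_k e k 0 *: p k) (\sum_k e k 0)%:M.
  rewrite mul_col_mx; congr col_mx.
    apply/colP => i; rewrite !mxE summxE; apply: eq_bigr => k _.
    by rewrite !mxE mulrC.
  apply/colP => i; rewrite !mxE ord1 eqxx mulr1n; apply: eq_bigr => k _.
  by rewrite !mxE mul1r.
have Mu : M \in unitmx.
  rewrite -unitmx_tr -row_free_unit -kermx_eq0.
  apply/eqP/row_matrixP => i; rewrite row0.
  have : row i (kermx M^T) *m M^T = 0 by rewrite -row_mul mulmx_ker row0.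
  move: (row i _) => u /(congr1 trmx); rewrite trmx_mul trmxK trmx0 ME.
  rewrite (_ : 0 = col_mx 0 0) => [/eq_col_mx[u1 u0]|]; last by rewrite col_mx0.
  have uT0 : \sum_k u^T k 0 = 0.
    by move/(congr1 (fun N : 'M[R]_1 => N 0 0)): u0; rewrite !mxE eqxx mulr1n.
  by apply/rowP => k; have := pI _ uT0 u1 k; rewrite !mxE.
pose N := invmx M.
pose a k := row k (lsubmx N); pose d k := rsubmx N k 0.
have cE k x : (a k *m x) 0 0 + d k = (N *m col_mx x 1%:M) k 0.
  rewrite -[N]hsubmxK mul_row_col mulmx1 [RHS]mxE; congr (_ + _).
  by rewrite -row_mul mxE.
have c_uniq e x : \sum_k e k = 1 -> x = \sum_k e k *: p k ->
    forall k, e k = (a k *m x) 0 0 + d k.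
  move=> e1 xE k; rewrite cE.
  have -> : col_mx x 1%:M = M *m (\col_k e k).
    rewrite ME -e1 [in LHS]xE; congr (col_mx _ _%:M).
      by apply: eq_bigr => i _; rewrite mxE.
    by apply: eq_bigr => i _; rewrite mxE.
  by rewrite mulKmx// mxE.
exists a, d; split => //.
- move=> k; apply/eqP => ak0.
  (* at the vertex [p j] the k-th coordinate would be 0 or 1, but also [d k] *)
  have vert j : (j == k)%:R = d k.
    have := @c_uniq (fun i => (j == i)%:R) (p j) _ _ k; rewrite ak0 mul0mx mxE add0r.
    apply; rewrite (bigD1 j)//= eqxx big1 ?addr0 ?scale1r// => i /negbTE ij;
      by rewrite eq_sym ij ?scale0r.
  have := vert k; rewrite -(vert (k + 1)) eqxx [_ == k]eq_sym.
  by rewrite (negbTE (ord4_neqD1 k)) => /eqP; rewrite oner_eq0.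
- move=> x; have : M *m (N *m col_mx x 1%:M) = col_mx x 1%:M by rewrite mulKVmx.
  rewrite ME => /eq_col_mx[x1 x2].
  under eq_bigr do rewrite cE; split.
    by move/(congr1 (fun N : 'M[R]_1 => N 0 0)): x2; rewrite !mxE !mulr1n.
  by rewrite -[LHS]x1; apply: eq_bigr => k _; rewrite cE.
Qed.

Lemma continuous_affine_form (R : realType) (a : 'rV[R]_3) (d : R) :
  continuous (fun x : 'cV[R]_3 => (a *m x) 0 0 + d).
Proof.
under eq_fun do rewrite mxE !big_ord_recr/= big_ord0 add0r.
move=> x.
have C j : {for x, continuous (fun y : 'cV[R]_3 => a 0 j * y j 0)}.
  exact: (@continuousM _ _ (fun=> a 0 j) (fun y : 'cV[R]_3 => y j 0) _
            (@cst_continuous _ _ _ _) (@coord_continuous _ _ _ j 0 x)).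
exact: (continuousD (continuousD (continuousD (C _) (C _)) (C _))
          (@cst_continuous _ _ d x)).
Qed.

Lemma nbhs_tetrahedron (R : realType) (p : 'I_4 -> 'cV[R]_3)
    (a : 'I_4 -> 'rV[R]_3) (d : 'I_4 -> R) (x : 'cV[R]_3) :
  (forall y, \sum_k ((a k *m y) 0 0 + d k) = 1 /\
     y = \sum_k ((a k *m y) 0 0 + d k) *: p k) ->
  (forall k, 0 < (a k *m x) 0 0 + d k) -> nbhs x (tetrahedron p).
Proof.
move=> bary x0.
have : \forall y \near x, forall k, 0 < (a k *m y) 0 0 + d k.
  apply: (@filter_forall _ _ (fun k y => 0 < (a k *m y) 0 0 + d k) (nbhs x)).
  by move=> k; exact: (@continuous_affine_form _ (a k) (d k) x _ (lt_nbhsr (x0 k))).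
apply: filterS => y y0; have [y1 yE] := bary y.
by exists (fun k => (a k *m y) 0 0 + d k); split => // k; exact: ltW.
Qed.

Lemma tetrahedron_vertex (R : realType) (p : 'I_4 -> 'cV[R]_3) k :
  tetrahedron p (p k).
Proof.
exists (fun j => (j == k)%:R); split => [j| |]; first by case: eqP.
  by rewrite (bigD1 k)//= eqxx big1 ?addr0// => j /negbTE ->.
by rewrite (bigD1 k)//= eqxx scale1r big1 ?addr0// => j /negbTE ->; rewrite scale0r.
Qed.

(** A point of the tetrahedron all of whose barycentric coordinates are positive
    is an interior point, so a boundary point lies in one of the four planes
    spanned by the faces. *)
Lemma tetrahedron_negligible_boundary (R : realType) (p : 'I_4 -> 'cV[R]_3) :
  affinely_independent p ->
  (@lebesgue3 R).-negligible
    (@vec3 R @^-1` [set x | tetrahedron p x /\ ~ nbhs x (tetrahedron p)]).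
Proof.
move=> /barycentric_coordinates[a [d [a0 bary baryU]]]; rewrite /lebesgue3.
apply: negligibleS (negligible_exists (fun k => hyperplane_negligible (d k) (a0 k))).
move=> z [[c [c0 c1 zc]] zN]; apply: contrapT => noz; apply: zN.
apply: (nbhs_tetrahedron bary) => k; rewrite lt_neqAle -(baryU c _ c1 zc) c0 andbT.
by apply/eqP => ck0; apply: noz; exists k; rewrite /= -(baryU c _ c1 zc).
Qed.

(** A point of the open box lies in some tetrahedron, because the tetrahedra
    cover the closure; the exceptional points lie on the planes carrying the
    faces of the box or on the boundary of a tetrahedron. *)
Lemma decomposition_ae_interior (R : realType) (n : nat) (p q : 'cV[R]_3)
    (T : 'I_n -> 'I_4 -> 'cV[R]_3) :
  tetrahedral_decomposition (interior (parallelepiped p q)) T ->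
  (@lebesgue3 R).-negligible (@vec3 R @^-1` [set x |
    ~ ((interior (parallelepiped p q) x <-> open_box p q x) /\
       (interior (parallelepiped p q) x ->
          exists t, nbhs x (tetrahedron (T t))))]).
Proof.
move=> [T_indep _ T_cover]; rewrite /lebesgue3.
apply: negligibleS (negligibleU (negligibleU
  (negligible_exists (fun i => coordinate_plane_negligible i (p i 0)))
  (negligible_exists (fun i => coordinate_plane_negligible i (q i 0))))
  (negligible_exists (fun t => tetrahedron_negligible_boundary (T_indep t)))).
move=> z /=; apply: contra_notP => /not_orP[/not_orP[zp zq] zT].
split.
  split; last exact: open_box_sub_interior.
  move/interior_subset/parallelepiped_open_boxP; apply => i.
  by split; apply/eqP => zi; [apply: zp|apply: zq]; exists i.
move=> /subset_closure; rewrite -T_cover => -[t _ zt]; exists t.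
by apply: contrapT => zN; apply: zT; exists t.
Qed.

Lemma grad_affine (R : realType) (v : 'cV[R]_3 -> 'cV[R]_3) (A : 'M[R]_3)
    (b x : 'cV[R]_3) :
  (\near x, v x = A *m x + b) -> grad v x = A.
Proof.
move=> vA; apply/matrixP => i j; rewrite mxE.
rewrite (@near_eq_derive _ _ _ _ (fun y : 'cV_3 => (A *m y + b) i 0)); last first.
  by apply: filterS vA => y ->.
rewrite /derive; apply: cvg_lim => //.
apply: cvg_near_cst; near=> h.
have h0 : h != 0 by near: h; exact: nbhs_dnbhs_neq.
rewrite /= mulmxDr -scalemxAr -colE !mxE -addrA addrK.
by rewrite [LHS]mulKf.
Unshelve. all: by end_near. Qed.

(** * Tetrahedra of type A *)

Lemma bond_vertex_coord (R : realType) (eps : R) (l eta : 'cV[int]_3)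
    (I : {set 'I_3}) i :
  bond_vertex eps l eta I i 0 = eps * (l i 0 + (if i \in I then eta i 0 else 0))%:~R.
Proof.
rewrite /bond_vertex /lattice_pt /intvec !mxE summxE; congr (_ * (_ + _)%:~R).
rewrite big_mkcond (bigD1 i)//= big1 ?addr0.
  by case: ifP; rewrite // !mxE !eqxx mulr1.
by move=> j ji; case: ifP; rewrite // !mxE eq_sym (negbTE ji) mulr0.
Qed.

Lemma bond_vertex0 (R : realType) (eps : R) (l eta : 'cV[int]_3) :
  bond_vertex eps l eta finset.set0 = lattice_pt eps l.
Proof. by rewrite /bond_vertex big_set0 addr0. Qed.

Lemma bond_vertexT (R : realType) (eps : R) (l eta : 'cV[int]_3) :
  bond_vertex eps l eta (finset.setTfor _) = lattice_pt eps (l + eta).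
Proof.
apply/colP => i; rewrite bond_vertex_coord finset.in_setT.
by rewrite /lattice_pt /intvec !mxE.
Qed.

Lemma bond_vertex_inj (R : realType) (eps : R) (l eta : 'cV[int]_3) :
  0 < eps -> (forall i, eta i 0 != 0) -> injective (@bond_vertex R eps l eta).
Proof.
move=> e0 eta0 I J IJ; apply/finset.setP => i.
have := congr1 (fun x : 'cV_3 => x i 0) IJ; rewrite !bond_vertex_coord.
move/(mulfI (lt0r_neq0 e0)) /intr_inj /addrI.
by case: ifP; case: ifP => // _ _ /eqP; rewrite ?[0 == _]eq_sym (negbTE (eta0 i)).
Qed.

(** The end points have comparable, distinct index sets; of this only the
    difference of the cardinals matters, which is insensitive to the
    orientation of the segment. *)
Lemma typeA_segment_card_neq (R : realType) (eps : R) (l eta : 'cV[int]_3)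
    (a b : 'cV[R]_3) :
  typeA_segment eps l eta a b ->
  exists I J : {set 'I_3}, [/\ a = bond_vertex eps l eta I,
    b = bond_vertex eps l eta J & #|I| != #|J|].
Proof.
case.
- move=> I i iI; exists I, (i |: I)%SET; split => //.
  by rewrite cardsU1 iI add1n neq_ltn ltnSn.
- exists finset.set0, (finset.setTfor _).
  by rewrite bond_vertex0 bond_vertexT cards0 cardsT card_ord.
- by move=> I I2; exists finset.set0, I; rewrite bond_vertex0 cards0 I2.
- move=> I I1; exists (finset.setTfor _), I.
  by rewrite bond_vertexT cardsT card_ord I1.
Qed.

(** The four index sets of the vertices of a tetrahedron have pairwise distinct
    cardinals between 0 and 3, hence each of these cardinals occurs; 0 is that
    of [x_l] and 3 that of [x_(l + eta)]. *)
Lemma typeA_main_diagonal_vertices (R : realType) (eps : R)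
    (l eta : 'cV[int]_3) (n : nat) (T : 'I_n -> 'I_4 -> 'cV[R]_3) (t : 'I_n) :
  0 < eps -> (forall i, eta i 0 != 0) ->
  (forall a b, tetrahedral_edge T a b ->
    typeA_segment eps l eta a b \/ typeA_segment eps l eta b a) ->
  (exists k, T t k = lattice_pt eps l) /\
  (exists k, T t k = lattice_pt eps (l + eta)).
Proof.
move=> e0 eta0 edgeA.
have edge j k : j != k -> exists I J : {set 'I_3},
    [/\ T t j = bond_vertex eps l eta I, T t k = bond_vertex eps l eta J
      & #|I| != #|J|].
  move=> jk; have /edgeA[] : tetrahedral_edge T (T t j) (T t k).
  - by exists t, j, k.
  - exact: typeA_segment_card_neq.
  - move=> /typeA_segment_card_neq[I [J [? ? ?]]]; exists J, I.
    by rewrite eq_sym.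
have /choice[V TV] : forall k, exists I, T t k = bond_vertex eps l eta I.
  by move=> k; have [I [_ [? _ _]]] := edge k (k + 1) (ord4_neqD1 k); exists I.
have card_inj : injective (fun k => inord #|V k| : 'I_4).
  have cardV k : (#|V k| < 4)%N by rewrite ltnS (leq_trans (max_card _))// card_ord.
  move=> j k; move/(congr1 val); rewrite /= !inordK// => Vjk.
  apply/eqP/negPn/negP => /edge[I [J []]]; rewrite !TV.
  by move=> /bond_vertex_inj<-// /bond_vertex_inj<-//; rewrite Vjk eqxx.
have onto (m : 'I_4) : exists k, #|V k| = val m.
  have /codomP[k ->] := injF_onto card_inj m.
  exists k; rewrite /= inordK// ltnS (leq_trans (max_card _))// card_ord//.
split.
  have [k Vk] := onto ord0; exists k.
  by rewrite TV -(bond_vertex0 _ _ eta); congr bond_vertex; apply: cards0_eq.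
have [k Vk] := onto ord_max; exists k.
rewrite TV -bond_vertexT; congr bond_vertex; apply/eqP.
by rewrite eqEcard finset.subsetT cardsT card_ord Vk.
Qed.

(** * Difference quotients as mean values of the gradient *)

Theorem lemma3p1 (R : realType) (eps : R) (l eta : 'cV[int]_3)
    (T : 'I_6 -> 'I_4 -> 'cV[R]_3) (v : 'cV[R]_3 -> 'cV[R]_3)
    (eps_gt0 : 0 < eps)
    (eta_neq0 : \prod_i eta i 0 != 0)
    (T_typeA : typeA_decomposition eps l eta T)
    (v_cont : {within closure (bond_volume eps l eta), continuous v})
    (v_affine : forall t : 'I_6, affine_on (tetrahedron (T t)) v) :
  eps ^+ 3 *: diff_quot eps eta v l =
  `|(\prod_i eta i 0)%:~R|^-1 *:
    integral3 (bond_volume eps l eta) (fun x => grad v x *m intvec R eta).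
Proof.
have eta0 i : eta i 0 != 0 by move/prodf_neq0: eta_neq0; exact.
have [T_dec T_edges] := T_typeA.
have stepE : lattice_pt eps (l + eta) - lattice_pt eps l = eps *: intvec R eta.
  by rewrite /lattice_pt /intvec map_mxD scalerDr addrC addKr.
have grad_eta t x : nbhs x (tetrahedron (T t)) ->
    grad v x *m intvec R eta = diff_quot eps eta v l.
  have [A [b vA]] := v_affine t => xT.
  have [[j Tj] [k Tk]] := typeA_main_diagonal_vertices t eps_gt0 eta0
    (fun a b => (T_edges a b).1).
  rewrite (@grad_affine _ _ A b); last by apply: filterS xT => y; exact: vA.
  rewrite /diff_quot -Tj -Tk !vA; [|exact: tetrahedron_vertex..].
  rewrite opprD addrACA subrr addr0 -mulmxBr Tj Tk stepE.
  rewrite -scalemxAr scalerA mulVf ?scale1r//.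
  exact: lt0r_neq0.
rewrite (@integral3_ae_const _ _ _ (lattice_pt eps l) (lattice_pt eps (l + eta))
  (diff_quot eps eta v l)); last first.
  apply: negligibleS (decomposition_ae_interior T_dec) => z /=.
  by apply: contra_not => -[DO zt]; split => // /zt[t]; exact: grad_eta.
rewrite [RHS]scalerA; congr (_ *: _).
rewrite (eq_bigr (fun i => eps * `|(eta i 0)%:~R|)) => [|i _]; last first.
  move/colP/(_ i): stepE; rewrite !mxE => ->.
  by rewrite normrM gtr0_norm.
rewrite big_split/= prodr_const card_ord rmorph_prod normr_prod mulrCA mulVf ?mulr1//.
by rewrite prodf_seq_neq0; apply/allP => i _; rewrite normr_eq0 intr_eq0 eta0.
Qed.
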